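(* Let $[n]$ be a finite set of agents, $\mathcal{C}$ a finite set of chores, and let all agents have the same valuation $v\colon 2^{\mathcal{C}}\to\mathbb{R}_{<0}$ such that every chore has negative marginal value, i.e. $v(S\cup\{c\})-v(S)<0$ for all $S\subseteq\mathcal{C}$ and $c\in\mathcal{C}\setminus S$. For every allocation $X=(X_1,\ldots,X_n)$ of $\mathcal{C}$, it is possible to reach an $\mathsf{EF1}$ allocation starting from $X$ by a sequence of valid transfers.
   Context: An allocation $X=(X_1,\ldots,X_n)$ is a partition of $\mathcal{C}$ into $n$ (possibly empty) bundles. For chores, the amount of $\mathsf{EF1}$-envy of agent $i$ towards agent $j$ in $X$ is $\varepsilon_{i\to j}(X)=\min_{c\in X_i}\{v(X_j)-v(X_i\setminus\{c\})\}$, with the convention $\varepsilon_{i\to j}(X)=v(X_j)-v(\emptyset)$ if $X_i=\emptyset$. Agent $i$ $\mathsf{EF1}$-envies $j$ if $v(X_i\setminus\{c\})<v(X_j)$ for all $c\in X_i$, i.e. $\varepsilon_{i\to j}(X)>0$ (an agent with an empty bundle $\mathsf{EF1}$-envies nobody). $X$ is $\mathsf{EF1}$ if no agent $\mathsf{EF1}$-envies another. A transfer moves a single chore from one agent's bundle to another agent's bundle, turning $X$ into $Y$. It is valid if for all $i,j\in[n]$, either $\varepsilon_{i\to j}(Y)\le 0$ or $\varepsilon_{i\to j}(Y)\le\varepsilon_{i\to j}(X)$. In a sequence of valid transfers, each transfer is valid with respect to the current allocation. *)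

(* Defs.v *)
From HB Require Import structures.
From mathcomp Require Import all_boot all_order all_algebra.
From mathcomp Require Import reals.

Set Implicit Arguments.
Unset Strict Implicit.
Unset Printing Implicit Defensive.

Import Order.TTheory GRing.Theory Num.Theory.
Local Open Scope ring_scope.

Definition bundles (n : nat) (C : finType) := {ffun 'I_n -> {set C}}.

Definition is_allocation (n : nat) (C : finType) (X : bundles n C) : bool :=
  [forall i, forall j, (i != j) ==> [disjoint X i & X j]]
  && (\bigcup_i X i == [set: C]).

(* The seed c0 of the iterated minimum lies in X i, so the value is exactly
   the minimum over the nonempty bundle X i. *)
Definition ef1_amount (R : realType) (n : nat) (C : finType)
    (v : {set C} -> R) (X : bundles n C) (i j : 'I_n) : R :=
  match [pick c in X i] with
  | Some c0 => \big[Num.min/v (X j) - v (X i :\ c0)]_(c in X i)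
                 (v (X j) - v (X i :\ c))
  | None => v (X j) - v set0
  end.

(* Without the first conjunct, an agent with an empty bundle would vacuously
   EF1-envy everybody. *)
Definition ef1_envies (R : realType) (n : nat) (C : finType)
    (v : {set C} -> R) (X : bundles n C) (i j : 'I_n) : bool :=
  (X i != set0) && [forall c in X i, v (X i :\ c) < v (X j)].

Definition is_EF1 (R : realType) (n : nat) (C : finType)
    (v : {set C} -> R) (X : bundles n C) : bool :=
  [forall i, forall j, (i != j) ==> ~~ ef1_envies v X i j].

Definition move_chore (n : nat) (C : finType) (X : bundles n C)
    (c : C) (i j : 'I_n) : bundles n C :=
  [ffun k => if k == i then X i :\ c
             else if k == j then c |: X j
             else X k].

Definition is_transfer (n : nat) (C : finType) (X Y : bundles n C) : bool :=
  [exists i, exists j, exists c,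
    [&& i != j, c \in X i & Y == move_chore X c i j]].

Definition valid_transfer (R : realType) (n : nat) (C : finType)
    (v : {set C} -> R) : rel (bundles n C) :=
  fun X Y => is_transfer X Y &&
    [forall i, forall j, (ef1_amount v Y i j <= 0)
                         || (ef1_amount v Y i j <= ef1_amount v X i j)].

Lemma ef1_enviesE (R : realType) (n : nat) (C : finType) (v : {set C} -> R)
    (hchore : forall (S : {set C}) (c : C), c \notin S -> v (c |: S) - v S < 0)
    (X : bundles n C) (i j : 'I_n) :
  ef1_envies v X i j = (0 < ef1_amount v X i j).
Proof.
have v_le0 (S : {set C}) : v S <= v set0.
  elim: {S}_.+1 {-2}S (ltnSn #|S|) => // m IH S hS.
  have [->//|[c cS]] := set_0Vmem S.
  have /ltW := hchore (S :\ c) c (negbT (setD11 _ _)).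
  rewrite subr_le0 setD1K // => /le_trans; apply; apply: IH.
  by rewrite (cardsD1 c) cS in hS.
rewrite /ef1_envies /ef1_amount; case: pickP => [c0 c0X|X0].
  have -> : X i != set0 by apply/set0Pn; exists c0.
  apply/forall_inP/idP => [h|].
    elim/big_ind: _ => [||c cX]; rewrite ?subr_gt0 ?h // => x y x0 y0.
    by rewrite lt_min x0.
  move=> h c cX; rewrite -subr_gt0; apply: (lt_le_trans h).
  exact: (bigmin_le_cond _ (fun c => v (X j) - v (X i :\ c))).
have -> : X i = set0 by apply/setP => c; rewrite inE; exact: X0.
by rewrite eqxx subr_gt0 ltNge v_le0.
Qed.

(* Main.v *)
Require Import Defs.
From HB Require Import structures.
From mathcomp Require Import all_boot all_order all_algebra.
From mathcomp Require Import reals.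

Set Implicit Arguments.
Unset Strict Implicit.
Unset Printing Implicit Defensive.

Import Order.TTheory GRing.Theory Num.Theory.
Local Open Scope ring_scope.

(** Write r(S) for the largest value of S minus one chore, so that the EF1-envy
    of i towards j is v(X_j) - r(X_i). While X is not EF1, take i minimizing
    r(X_i) and j maximizing v(X_j), and move from i to j a chore c with
    v(X_i - c) = r(X_i). Afterwards nobody envies i, since v(X_i - c) = r(X_i)
    is at most every r(X_k), and j envies nobody, since r(X_j + c) >= v(X_j).
    Both changed bundles end up with value below v(X_j), the former maximum,
    because i EF1-envied j. Hence the process stops: the weight
    sum_k 2^(number of sets worth less than X_k) strictly decreases. *)

(* The seed v S only matters for S = set0: it is below every v (S :\ c). *)
Definition best_removal (R : realType) (C : finType) (v : {set C} -> R)
    (S : {set C}) : R :=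
  \big[Num.max/v S]_(c in S) v (S :\ c).

Definition weight (R : realType) (n : nat) (C : finType) (v : {set C} -> R)
    (X : bundles n C) : nat :=
  (\sum_i 2 ^ #|[set T : {set C} | (v T < v (X i))%R]|)%N.

(** The invariant of the process: a chore taken from one bundle is new to the receiver, so it lowers
    the receiver's value. *)
Definition pairwise_disjoint (n : nat) (C : finType) (X : bundles n C) :=
  forall i j c, c \in X i -> c \in X j -> i = j.

Section Chores.
Variables (R : realType) (C : finType) (v : {set C} -> R).
Hypothesis v_chore :
  forall (S : {set C}) (c : C), c \notin S -> v (c |: S) - v S < 0.

Lemma chore_lt (S : {set C}) c : c \notin S -> v (c |: S) < v S.
Proof. by move=> /v_chore; rewrite subr_lt0. Qed.

Lemma removal_gt (S : {set C}) c : c \in S -> v S < v (S :\ c).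
Proof. by move=> cS; rewrite -{1}(setD1K cS) chore_lt // setD11. Qed.

Lemma best_removal_ge (S : {set C}) : v S <= best_removal v S.
Proof. exact: bigmax_ge_id. Qed.

Lemma removal_le_best (S : {set C}) c :
  c \in S -> v (S :\ c) <= best_removal v S.
Proof. by move=> cS; apply: (le_bigmax_cond _ (fun c => v (S :\ c))). Qed.

Lemma best_removalP (S : {set C}) :
  S != set0 -> exists2 c, c \in S & best_removal v S = v (S :\ c).
Proof.
case/set0Pn=> c0 c0S.
have [c cS /= cmax] :=
  @Order.TotalTheory.arg_maxP _ _ _ c0 (mem S) (fun c => v (S :\ c)) c0S.
exists c => //; apply/le_anti; rewrite removal_le_best // andbT.
by apply/bigmax_leP; split=> [|b bS]; [apply/ltW/removal_gt | apply: cmax].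
Qed.

(** Subtraction from [v (X j)] turns the minimum into a maximum. For an empty bundle the seed
    [v set0] of [best_removal] matches the convention. *)
Lemma ef1_amountE n (X : bundles n C) i j :
  ef1_amount v X i j = v (X j) - best_removal v (X i).
Proof.
rewrite /ef1_amount; case: pickP => [c0 c0X|X0]; last first.
  have -> : X i = set0 by apply/setP => c; rewrite inE; exact: X0.
  by rewrite /best_removal big_set0.
have [|c cX rE] := @best_removalP (X i); first by apply/set0Pn; exists c0.
apply/le_anti/andP; split.
  by rewrite rE; apply: (bigmin_le_cond _ (fun c => v (X j) - v (X i :\ c))).
by apply/bigmin_geP; split=> [|b bX]; rewrite lerD2l lerN2 removal_le_best.
Qed.

Lemma move_chore_disjoint n (X : bundles n C) c i j :
  i != j -> c \in X i -> pairwise_disjoint X ->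
  pairwise_disjoint (move_chore X c i j).
Proof.
move=> ij cX dX.
have mem_move k b :
    (b \in move_chore X c i j k) = if b == c then k == j else b \in X k.
  rewrite ffunE; case: (eqVneq k i) => [->|ki].
    by rewrite !inE (negPf ij); case: eqVneq.
  case: (eqVneq k j) => [->|kj]; first by rewrite !inE; case: eqVneq.
  by case: eqVneq => // ->; apply/negbTE; apply: contra ki => /dX /(_ cX)/eqP.
move=> k l b; rewrite !mem_move.
by case: eqP => [_ /eqP -> /eqP ->|_]; last exact: dX.
Qed.

Lemma weight_move n (X : bundles n C) c i j :
  i != j -> c \notin X j -> v (X i :\ c) < v (X j) ->
  (weight v (move_chore X c i j) < weight v X)%N.
Proof.
move=> ij cXj lt_ij; have ji : j != i by rewrite eq_sym.
rewrite /weight !(bigD1 j (P := predT)) //=.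
rewrite !(bigD1 i (P := fun k => k != j)) //=.
rewrite [X in (_ + (_ + X) < _)%N](_ : _ =
    \sum_(k | (k != j) && (k != i)) 2 ^ #|[set T | (v T < v (X k))%R]|)%N;
  last by apply: eq_bigr => k /andP[kj ki]; rewrite ffunE (negPf ki) (negPf kj).
rewrite !ffunE eqxx (negPf ji) eqxx !addnA ltn_add2r.
have rank_lt S : v S < v (X j) ->
    (#|[set T : {set C} | (v T < v S)%R]|
      < #|[set T : {set C} | (v T < v (X j))%R]|)%N.
  move=> SXj; apply/proper_card/properP; split.
    by apply/subsetP => T; rewrite !inE => /lt_trans; apply.
  (* [S] itself is counted for [X j] but not for [S]. *)
  by exists S; rewrite inE // ltxx.
have := rank_lt _ lt_ij; have := rank_lt _ (chore_lt cXj).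
case: #|[set T : {set C} | (v T < v (X j))%R]| => // m.
(* The two new terms are at most [2 ^ m] each, together at most the old term [2 ^ m.+1] of [j];
   strictness comes from the old term of [i], which is positive. *)
rewrite !ltnS => le1 le2; rewrite expnS mul2n -addnn -[ltnLHS]addn0 -addnS.
by rewrite leq_add ?leq_add ?leq_pexp2l ?expn_gt0.
Qed.

Lemma valid_move n (X : bundles n C) c i j :
  i != j -> c \in X i -> c \notin X j ->
  best_removal v (X i) = v (X i :\ c) ->
  (forall k, best_removal v (X i) <= best_removal v (X k)) ->
  (forall k, v (X k) <= v (X j)) ->
  v (X i :\ c) < v (X j) ->
  valid_transfer v X (move_chore X c i j).
Proof.
move=> ij cXi cXj rE imin jmax lt_ij; have ji : j != i by rewrite eq_sym.
have jbest : v (X j) <= best_removal v (c |: X j).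
  by rewrite -{1}(setU1K cXj) removal_le_best ?setU11.
apply/andP; split.
  by apply/'exists_'exists_existsP; exists i, j, c; rewrite ij cXi eqxx.
apply/forallP => k; apply/forallP => l.
rewrite !ef1_amountE subr_le0 !ffunE.
case: (eqVneq k l) => [->|kl]; first by rewrite best_removal_ge.
(* Giver [i]: its best removal does not drop, and no other bundle gains value. *)
case: (eqVneq k i) kl => [->|ki] kl.
  rewrite eq_sym (negPf kl); apply/orP; right; apply: lerB.
    by case: eqP => [->|//]; apply/ltW/chore_lt.
  by rewrite rE best_removal_ge.
(* Receiver [j]: every other bundle is worth at most [v (X j)], the new bundle of [i] by [lt_ij]. *)
case: (eqVneq k j) kl => [->|kj] kl.
  apply/orP; left; apply: le_trans jbest.
  by rewrite [l == j]eq_sym (negPf kl); case: eqP => // _; apply/ltW.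
(* A bystander [k] keeps its bundle: only its envy towards [i] could grow, and minimality of [i]
   makes that amount nonpositive. *)
case: (eqVneq l i) => [_|li]; first by rewrite -rE imin.
by case: eqP => [->|//]; rewrite ?lexx ?orbT // lerB ?orbT // ltW // chore_lt.
Qed.

Lemma improving_transfer n (X : bundles n C) :
  pairwise_disjoint X -> ~~ is_EF1 v X ->
  exists Y, [/\ valid_transfer v X Y, pairwise_disjoint Y
               & (weight v Y < weight v X)%N].
Proof.
move=> dX /forallPn[i0 /forallPn[j0]].
rewrite negb_imply negbK ef1_enviesE // ef1_amountE subr_gt0 => /andP[_ envy].
have [i _ imin] := Order.TotalTheory.arg_minP
  (fun k => best_removal v (X k)) (erefl : predT i0).
have [j _ jmax] := Order.TotalTheory.arg_maxP
  (fun k => v (X k)) (erefl : predT j0).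
(* Passing from [i0], [j0] to the extremal pair can only increase the envy. *)
have {}envy : best_removal v (X i) < v (X j).
  exact: le_lt_trans (imin i0 _) (lt_le_trans envy (jmax j0 _)).
(* No agent has positive envy towards itself. *)
have ij : i != j.
  by apply: contraTneq envy => ->; rewrite -leNgt best_removal_ge.
have Xi : X i != set0.
  have: ef1_envies v X i j by rewrite ef1_enviesE // ef1_amountE subr_gt0.
  by case/andP.
have [c cXi rE] := best_removalP Xi; rewrite rE in envy.
have cXj : c \notin X j by apply: contra ij => /(dX _ _ _ cXi)/eqP.
exists (move_chore X c i j); split.
- by apply: valid_move => // k; [exact: imin | exact: jmax].
- exact: move_chore_disjoint.
- exact: weight_move.
Qed.

End Chores.

Theorem theorem7 (R : realType) (n : nat) (C : finType) (v : {set C} -> R)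
  (v_neg : forall S : {set C}, v S < 0)
  (v_chore : forall (S : {set C}) (c : C), c \notin S -> v (c |: S) - v S < 0)
  (X : bundles n C) (X_alloc : is_allocation X) :
  exists s : seq (bundles n C),
    path (valid_transfer v) X s /\ is_EF1 v (last X s).
Proof.
have {X_alloc}: pairwise_disjoint X.
  case/andP: X_alloc => /forallP dX _ i j c ci cj; apply/eqP.
  have /forallP/(_ j)/implyP {}dX := dX i.
  by apply: contraTT cj => /dX /disjointFr ->.
elim: {X}(weight v X).+1 {-2}X (ltnSn (weight v X)) => // m IH X Xm dX.
have [EX|/improving_transfer] := boolP (is_EF1 v X); first by exists [::].
case/(_ v_chore dX) => Y [XY dY /leq_trans/(_ Xm) Ym].
have [s [Ys Es]] := IH Y Ym dY.
by exists (Y :: s); rewrite /= XY.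
Qed.
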